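(* Let $(\mathcal{X},d)$ be a complete separable metric space and $P_1,\dots,P_{J+1}$ Borel probability measures on $\mathcal{X}$ with $\mathbb{E}_{P_j}[d(Y,y_0)]<\infty$ for some $y_0\in\mathcal{X}$ and all $j$. Assume $\{P_2,\dots,P_{J+1}\}$ are affinely independent ($\sum_{j=2}^{J+1}\alpha_jP_j=0$ and $\sum_j\alpha_j=0$ imply all $\alpha_j=0$) and let $\eta>0$. For each $N$ and each $j\in\{1,\dots,J+1\}$ let $Y_j^{(1)},\dots,Y_j^{(N)}$ be i.i.d. draws from $P_j$ and $\hat P_{j,N}=\frac1N\sum_{k=1}^N\delta_{Y_j^{(k)}}$. Let $$\hat\lambda_N\in\arg\min_{\lambda\in\Delta^{J-1}}\Big[W_1\Big(\sum_{j=2}^{J+1}\lambda_j\hat P_{j,N},\hat P_{1,N}\Big)+\eta\sum_{j=2}^{J+1}\lambda_j\log\lambda_j\Big]$$ and let $\lambda^*$ be the unique minimizer over $\Delta^{J-1}$ of $Q_\eta(\lambda)=W_1(\sum_{j=2}^{J+1}\lambda_jP_j,P_1)+\eta\sum_{j=2}^{J+1}\lambda_j\log\lambda_j$. Then $\hat\lambda_N\to\lambda^*$ in probability as $N\to\infty$.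
   Context: $\Delta^{J-1}=\{\lambda\in\mathbb{R}^J:\lambda_j\ge0,\sum_{j=2}^{J+1}\lambda_j=1\}$ with coordinates indexed by $j=2,\dots,J+1$; $0\log0=0$. $W_1$ is the Wasserstein-1 distance; $\delta_y$ is the Dirac mass at $y$. *)

(* Defs.v *)
From HB Require Import structures.
From mathcomp Require Import all_boot all_order all_algebra.
From mathcomp Require Import all_classical all_reals all_analysis.
Set Implicit Arguments. Unset Strict Implicit. Unset Printing Implicit Defensive.
Import Order.TTheory GRing.Theory Num.Theory.
Import numFieldNormedType.Exports.
Local Open Scope classical_set_scope.
Local Open Scope ring_scope.

Section Defs.
Context {R : realType}.

Definition is_metric {X : Type} (dist : X -> X -> R) :=
  [/\ forall x y, dist x y = 0 <-> x = y,
      forall x y, dist x y = dist y x &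
      forall x y z, dist x z <= dist x y + dist y z].

Definition metric_open {X : Type} (dist : X -> X -> R) : set (set X) :=
  [set U | forall x, U x -> exists2 e : R, 0 < e & [set y | dist x y < e] `<=` U].

Definition metric_cauchy {X : Type} (dist : X -> X -> R) (u : nat -> X) :=
  forall e : R, 0 < e -> exists N, forall m n, (N <= m)%N -> (N <= n)%N -> dist (u m) (u n) < e.

Definition metric_complete {X : Type} (dist : X -> X -> R) :=
  forall u : nat -> X, metric_cauchy dist u ->
    exists l, forall e : R, 0 < e -> exists N, forall n, (N <= n)%N -> dist (u n) l < e.

(* separable: has a countable dense subset (a dense sequence, X being nonempty) *)
Definition metric_separable {X : Type} (dist : X -> X -> R) :=
  (X -> False) \/ exists s : nat -> X,
    forall x (e : R), 0 < e -> exists n, dist x (s n) < e.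

Context {dX : measure_display} {X : measurableType dX}.

Definition coupling (mu nu : set X -> \bar R) (pi : probability (X * X)%type R) :=
  forall A : set X, measurable A -> pi (A `*` setT) = mu A /\ pi (setT `*` A) = nu A.

Definition W1 (dist : X -> X -> R) (mu nu : set X -> \bar R) : \bar R :=
  ereal_inf [set (\int[pi]_z (dist z.1 z.2)%:E)%E
            | pi in [set pi : probability (X * X)%type R | coupling mu nu pi]].

Definition mixture (J : nat) (lam : 'I_J -> R) (mus : 'I_J -> set X -> \bar R) :
  set X -> \bar R := fun A => (\sum_(i < J) (lam i)%:E * mus i A)%E.

Definition empirical {T : Type} (N : nat) (Z : nat -> T -> X) (w : T) :
  set X -> \bar R := fun A => ((N%:R)^-1%:E * \sum_(k < N) (\d_(Z k w) : set X -> \bar R) A)%E.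

Definition simplex (J : nat) : set ('I_J -> R) :=
  [set lam | (forall i, 0 <= lam i) /\ \sum_(i < J) lam i = 1].

Definition xlogx (x : R) : R := if x == 0 then 0 else x * ln x.

Definition objective (dist : X -> X -> R) (eta : R) (J : nat)
    (mus : 'I_J -> set X -> \bar R) (mu1 : set X -> \bar R) (lam : 'I_J -> R) : \bar R :=
  (W1 dist (mixture lam mus) mu1 + (eta * \sum_(i < J) xlogx (lam i))%:E)%E.

Definition is_argmin (J : nat) (Q : ('I_J -> R) -> \bar R) (lam : 'I_J -> R) :=
  @simplex J lam /\ forall l, @simplex J l -> (Q lam <= Q l)%E.

Context {dO : measure_display} {Omega : measurableType dO}.

Definition mutually_independent (Pr : probability Omega R) (Z : nat -> Omega -> X) :=
  forall (s : seq nat) (A : nat -> set X), uniq s -> (forall k, measurable (A k)) ->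
    Pr (\bigcap_(k in [set k | k \in s]) (Z k @^-1` A k)) =
    (\prod_(k <- s) Pr (Z k @^-1` A k))%E.

Definition iid_with_law (Pr : probability Omega R) (Z : nat -> Omega -> X)
    (P : probability X R) :=
  [/\ forall k, measurable_fun setT (Z k),
      forall k A, measurable A -> Pr (Z k @^-1` A) = P A &
      mutually_independent Pr Z].

(* convergence in (outer) probability of a sequence of possibly non-measurable
   maps to a constant, with l1 distance on R^J *)
Definition cvg_in_outer_prob (Pr : probability Omega R) (J : nat)
    (Z : nat -> Omega -> 'I_J -> R) (c : 'I_J -> R) :=
  forall eps delta : R, 0 < eps -> 0 < delta ->
    exists N0, forall N, (N0 <= N)%N ->
      exists2 B : set Omega, measurable B /\
        [set w | eps < \sum_(i < J) `|Z N w i - c i|] `<=` B & (Pr B < delta%:E)%E.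

End Defs.

(* Main.v *)
Require Import Defs.
From HB Require Import structures.
From mathcomp Require Import all_boot all_order all_algebra.
From mathcomp Require Import all_classical all_reals all_analysis.
From mathcomp Require Import measurable_realfun ring lra.
Set Implicit Arguments. Unset Strict Implicit. Unset Printing Implicit Defensive.
Import Order.TTheory GRing.Theory Num.Theory.
Import numFieldNormedType.Exports.
Local Open Scope classical_set_scope.
Local Open Scope ring_scope.

(** Cut X into finitely many measurable cells with centres such that a point is
    on average close to the centre of its cell, under each P_j. Up to these
    quantization errors, the cost of a coupling is a function of the masses it
    gives to products of cells. A matrix of masses can be moved to nearby
    marginals at a cost controlled by the change of the cell masses, and every
    matrix with the right marginals is realized by a coupling (a mixture of
    products of conditional laws). Hence W_1 is stable under changing both
    measures, without gluing couplings. For empirical measures the quantization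
    error is controlled by Markov's inequality and the cell frequencies by
    Chebyshev's, so with high probability the empirical objective is uniformly
    close to Q_eta on the simplex. Since W_1 is convex along mixtures and the
    entropy is strongly midpoint convex, a near minimizer of Q_eta is
    quantitatively close to lambda^*. *)

(** * Mixtures and conditional laws *)

Section ProbabilityConstructions.
Context {R : realType} {d : measure_display} {T : measurableType d}.

Lemma ge0_integral_law d' (T' : measurableType d')
    (mu : {measure set T -> \bar R}) (nu : {measure set T' -> \bar R})
    (phi : T -> T') (f : T' -> \bar R) :
  measurable_fun setT phi ->
  (forall A, measurable A -> mu (phi @^-1` A) = nu A) ->
  measurable_fun setT f -> (forall y, 0 <= f y)%E ->
  (\int[mu]_x f (phi x) = \int[nu]_y f y)%E.
Proof.
move=> mphi law mf f0.
rewrite -[LHS](ge0_integral_pushforward mphi _ measurableT mf)//.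
by apply: eq_measure_integral => A mA _; rewrite /= /pushforward law.
Qed.

(* For I = 'I_J this is convertible to membership in simplex, whose proofs are
   passed below where convex_weights is expected. *)
Definition convex_weights (I : finType) (lam : I -> R) :=
  (forall i, 0 <= lam i) /\ \sum_i lam i = 1.

Section MixtureProb.
Context {I : finType} {lam : I -> R}.
Hypothesis lamP : convex_weights lam.
Variable mus : I -> probability T R.

Let component (k : nat) : {measure set T -> \bar R} :=
  if insub k is Some j then
    mscale (NngNum (proj1 lamP (enum_val (j : 'I_#|I|)))) (mus (enum_val j))
  else mzero.

Let sum_enum_val (F : I -> \bar R) :
  (\sum_i F i = \sum_(j < #|I|) F (enum_val j))%E.
Proof. by rewrite -(big_enum_val F). Qed.

Let msum_component A : msum component #|I| A = (\sum_i (lam i)%:E * mus i A)%E.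
Proof.
by rewrite sum_enum_val; apply: eq_bigr => j _; rewrite /component valK.
Qed.

Let msum_component_setT : msum component #|I| setT = 1%E.
Proof.
rewrite msum_component -(proj2 lamP) -sumEFin; apply: eq_bigr => i _.
by rewrite probability_setT mule1.
Qed.

Definition mixture_prob : probability T R :=
  HB.pack (msum component #|I|)
    (Measure_isProbability.Build _ _ _ (msum component #|I|)
       msum_component_setT).

Lemma mixture_probE A : mixture_prob A = (\sum_i (lam i)%:E * mus i A)%E.
Proof. exact: msum_component. Qed.

Lemma integral_mixture_prob (f : T -> \bar R) :
  measurable_fun setT f -> (forall x, 0 <= f x)%E ->
  (\int[mixture_prob]_x f x = \sum_i (lam i)%:E * \int[mus i]_x f x)%E.
Proof.
move=> mf f0; rewrite ge0_integral_measure_sum// sum_enum_val.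
by apply: eq_bigr => j _; rewrite /component valK ge0_integral_mscale.
Qed.

Lemma sum_mixture_le (F : I -> \bar R) (x : R) :
  (forall i, F i <= x%:E)%E -> (\sum_i (lam i)%:E * F i <= x%:E)%E.
Proof.
case: lamP => lam0 lam1 Fx; rewrite -[x]mul1r -lam1 mulr_suml -sumEFin.
by apply: lee_sum => i _; rewrite EFinM lee_wpmul2l// lee_fin.
Qed.

End MixtureProb.

Lemma convex_weights_itv (I : finType) (lam : I -> R) :
  convex_weights lam -> forall i, 0 <= lam i <= 1.
Proof. by move=> [l0 l1] i; rewrite l0 -l1 (bigD1 i)//= lerDl sumr_ge0. Qed.

Lemma convex_weights_midpoint (I : finType) (lam lam' : I -> R) :
  convex_weights lam -> convex_weights lam' ->
  convex_weights (fun i => (lam i + lam' i) / 2).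
Proof.
move=> [l0 l1] [l0' l1']; split=> [i|]; first by rewrite divr_ge0// addr_ge0.
by rewrite -mulr_suml big_split/= l1 l1' divff.
Qed.

Lemma convex_weights_half : convex_weights (fun _ : bool => 2^-1 : R).
Proof. by split=> [b|]; rewrite ?invr_ge0// big_bool/= [RHS]splitr div1r. Qed.

Definition cond_prob (mu : probability T R) (C : set T) (mC : measurable C) :
  probability T R := mnormalize (mrestr mu mC) mu.

Lemma cond_probE (mu : probability T R) C (mC : measurable C) A :
  measurable A -> (mu C * cond_prob mu mC A = mu (A `&` C))%E.
Proof.
move=> mA; have Coo : mu C \is a fin_num by rewrite fin_num_measure.
rewrite /= /mnormalize /= /mrestr setTI.
have [C0|C0] := eqVneq (mu C) 0%E.
  rewrite C0 mul0e; apply/esym/eqP; rewrite eq_le measure_ge0 andbT -C0.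
  by rewrite le_measure ?inE//; exact: measurableI.
have /negPf -> : mu C != +oo%E by apply: contraTneq Coo => ->.
rewrite /= muleCA -[X in (_ * (X * _))%E](fineK Coo) -EFinM divff ?mule1//.
by rewrite fine_eq0.
Qed.

Lemma mixture_prob_cst (I : finType) (lam : I -> R) (lamP : convex_weights lam)
    (mu : probability T R) A :
  mixture_prob lamP (fun=> mu) A = mu A.
Proof.
have [lam0 lam1] := lamP; rewrite mixture_probE -ge0_sume_distrl => [|i _].
  by rewrite sumEFin lam1 mul1e.
by rewrite lee_fin.
Qed.

Lemma mixture_prob_midpoint (I : finType) (lam lam' : I -> R)
    (lamP : convex_weights lam) (lamP' : convex_weights lam')
    (midP : convex_weights (fun i => (lam i + lam' i) / 2))
    (mus : I -> probability T R) A :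
  mixture_prob midP mus A = ((2^-1)%:E * mixture_prob lamP mus A +
    (2^-1)%:E * mixture_prob lamP' mus A)%E.
Proof.
have [lam0 _] := lamP; have [lam0' _] := lamP'.
rewrite !mixture_probE !ge0_sume_distrr; last 2 first.
- by move=> i _; rewrite mule_ge0// lee_fin.
- by move=> i _; rewrite mule_ge0// lee_fin.
rewrite -big_split; apply: eq_bigr => i _ /=.
rewrite !muleA -!EFinM -ge0_muleDl ?lee_fin ?mulr_ge0 ?invr_ge0//.
by rewrite -EFinD -mulrDr mulrC.
Qed.

Lemma mixture_mixture_prob J (l : 'I_J -> R) (lP : simplex l)
    (mus : 'I_J -> probability T R) :
  mixture l (fun j => mus j : set T -> \bar R) = mixture_prob lP mus.
Proof. by apply/funext => A; rewrite mixture_probE. Qed.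

End ProbabilityConstructions.

Section Cells.
Context {R : realType} {d : measure_display} {T : measurableType d}.
Context {I : finType} (idx : T -> I).
Implicit Types mu : probability T R.

Definition cell (a : I) : set T := idx @^-1` [set a].

Definition cell_mass (mu : set T -> \bar R) a : R := fine (mu (cell a)).

Lemma cell_mass_ge0 mu a : 0 <= cell_mass mu a.
Proof. exact: fine_ge0. Qed.

Hypothesis measurable_cell : forall a, measurable (cell a).

Lemma EFin_cell_mass mu a : (cell_mass mu a)%:E = mu (cell a).
Proof. by rewrite fineK// fin_num_measure. Qed.

Lemma measure_cells mu A : measurable A -> mu A = (\sum_a mu (A `&` cell a))%E.
Proof.
move=> mA.
rewrite fsbig_seq ?index_enum_uniq// -measure_fin_bigcup//.
- rewrite -setI_bigcupr (_ : \bigcup_(a in _) _ = setT) ?setIT// -subTset.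
  by move=> x _; exists (idx x) => //=; rewrite mem_index_enum.
- by move=> a b _ _ [x [[_ /= <-] [_ /= <-]]].
- by move=> a _; exact: measurableI.
Qed.

Lemma sum_fine_measure_cells mu A : measurable A ->
  \sum_a fine (mu (A `&` cell a)) = fine (mu A).
Proof.
move=> mA; rewrite (measure_cells mu mA) -sum_fine// => a _.
by rewrite fin_num_measure//; exact: measurableI.
Qed.

Lemma sum_cell_mass mu : \sum_a cell_mass mu a = 1.
Proof.
rewrite -[RHS]/(fine 1%E) -(probability_setT mu) -sum_fine_measure_cells//.
by apply: eq_bigr => a _; rewrite setTI.
Qed.

Lemma cell_mass_mixture_prob (K : finType) (lam : K -> R)
    (lamP : convex_weights lam) (mus : K -> probability T R) a :
  cell_mass (mixture_prob lamP mus) a = \sum_i lam i * cell_mass (mus i) a.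
Proof.
apply: EFin_inj; rewrite EFin_cell_mass mixture_probE -sumEFin.
by apply: eq_bigr => i _; rewrite EFinM EFin_cell_mass.
Qed.

Lemma integral_cells mu (F : I -> R) : (forall a, 0 <= F a) ->
  (\int[mu]_x (F (idx x))%:E = (\sum_a F a * cell_mass mu a)%:E)%E.
Proof.
move=> F0; have mind a : measurable_fun setT (fun x => (\1_(cell a) x : R)%:E).
  by apply/measurable_EFinP; exact: measurable_indic.
transitivity (\int[mu]_x \sum_a (F a)%:E * (\1_(cell a) x)%:E)%E.
  apply: eq_integral => x _; rewrite (bigD1 (idx x))//= big1 ?adde0.
    by rewrite indicE mem_set ?mule1.
  by move=> a /eqP ax; rewrite indicE memNset ?mule0// => /esym.
rewrite ge0_integral_sum//; last 2 first.
- by move=> a; apply: emeasurable_funM.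
- by move=> a x _; rewrite mule_ge0// lee_fin.
rewrite -sumEFin; apply: eq_bigr => a _.
rewrite ge0_integralZl ?lee_fin// integral_indic// setIT.
by rewrite EFinM EFin_cell_mass.
Qed.

Definition cell_prob mu a := cond_prob mu (measurable_cell a).

Lemma cell_prob_cell mu a b : cell_mass mu a != 0 ->
  cell_prob mu a (cell b) = (a == b)%:R%:E.
Proof.
move=> mua; have := cond_probE mu (measurable_cell a) (measurable_cell b).
have -> : cell b `&` cell a = if a == b then cell a else set0.
  case: eqVneq => [->|ab]; first by rewrite setIid.
  by rewrite -subset0 => x [/= xb xa]; rewrite -xa -xb eqxx in ab.
rewrite (fun_if mu) measure0 -EFin_cell_mass.
rewrite -[cond_prob _ _ _]fineK ?fin_num_measure//.
case: eqP => _; rewrite -EFinM => -[] h; congr EFin; apply: (mulfI mua).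
  by rewrite h mulr1.
by rewrite h mulr0.
Qed.

End Cells.

(** * Transport plans between finite distributions *)

Section TransportPlans.
Context {R : realType}.

Section Plans.
Context {I K : finType}.
Implicit Types (u : I -> R) (v : K -> R) (M N D : I -> K -> R).

Definition transport_plan u v M :=
  [/\ forall a b, 0 <= M a b,
      forall a, \sum_b M a b = u a &
      forall b, \sum_a M a b = v b].

Definition plan_cost D M := \sum_a \sum_b M a b * D a b.

Lemma transport_plan_ge0 u v M a : transport_plan u v M -> 0 <= u a.
Proof. by move=> [M0 <- _]; rewrite sumr_ge0. Qed.

Lemma plan_costD D M N :
  plan_cost D (fun a b => M a b + N a b) = plan_cost D M + plan_cost D N.
Proof.
rewrite -big_split; apply: eq_bigr => a _; rewrite -big_split.
by apply: eq_bigr => b _; rewrite mulrDl.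
Qed.

Lemma plan_cost_le_total D u v M (Dmax : R) :
  transport_plan u v M -> (forall a b, D a b <= Dmax) ->
  plan_cost D M <= Dmax * \sum_a u a.
Proof.
move=> [M0 Mu _] DDmax; rewrite mulr_sumr; apply: ler_sum => a _.
by rewrite -Mu mulr_sumr; apply: ler_sum => b _; rewrite mulrC ler_wpM2r.
Qed.

Lemma product_plan u v : (forall a, 0 <= u a) -> (forall b, 0 <= v b) ->
  \sum_a u a = \sum_b v b ->
  transport_plan u v (fun a b => u a * v b / \sum_c u c).
Proof.
move=> u0 v0 uv.
have cancel_total (L : finType) (w : L -> R) c : (forall i, 0 <= w i) ->
    \sum_i w i = \sum_a u a -> w c * ((\sum_a u a) / \sum_a u a) = w c.
  move=> w0 wu; have [u_0|u_neq0] := eqVneq (\sum_a u a) 0.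
    by rewrite (psumr_eq0P (fun i _ => w0 i) (etrans wu u_0))// mul0r.
  by rewrite divff// mulr1.
split=> [a b|a|b].
- by rewrite divr_ge0 ?mulr_ge0 ?sumr_ge0.
- by rewrite -mulr_suml -mulr_sumr -uv -mulrA cancel_total.
- by rewrite -!mulr_suml mulrAC mulrC cancel_total.
Qed.

(* Scaling the rows of M down to the overlap of u and u' keeps that part of the
   mass in place; the remaining mass is spread as a product plan. *)
Lemma transport_plan_perturb_rows D u u' v M (Dmax : R) :
  transport_plan u v M -> (forall a, 0 <= u' a) -> \sum_a u' a = \sum_a u a ->
  (forall a b, 0 <= D a b) -> (forall a b, D a b <= Dmax) -> 0 <= Dmax ->
  exists2 M', transport_plan u' v M' &
    plan_cost D M' <= plan_cost D M + Dmax * \sum_a `|u a - u' a|.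
Proof.
move=> planM u'0 totalu' D0 DDmax Dmax0; have [M0 Mu Mv] := planM.
have u0 a : 0 <= u a := transport_plan_ge0 a planM.
pose overlap a := Num.min (u a) (u' a).
pose kept a := overlap a / u a.
have kept01 a : 0 <= kept a <= 1.
  rewrite divr_ge0 ?le_min ?u0//= /kept; have [->|ua] := eqVneq (u a) 0.
    by rewrite invr0 mulr0.
  by rewrite ler_pdivrMr ?mul1r ?ge_min ?lexx// lt_def ua u0.
have u_kept a : u a * kept a = overlap a.
  have [ua|ua] := eqVneq (u a) 0; last by rewrite mulrC divfK.
  by rewrite ua mul0r /overlap ua min_l.
pose missing a := u' a - overlap a.
pose freed b := \sum_a M a b * (1 - kept a).
have missing0 a : 0 <= missing a by rewrite subr_ge0 ge_min lexx orbT.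
have freed0 b : 0 <= freed b.
  by apply: sumr_ge0 => a _; rewrite mulr_ge0// subr_ge0; case/andP: (kept01 a).
have total_missing : \sum_a missing a = \sum_b freed b.
  rewrite /freed exchange_big/= sumrB totalu' -sumrB; apply: eq_bigr => a _.
  by rewrite -mulr_suml Mu mulrBr mulr1 u_kept.
have planN := product_plan missing0 freed0 total_missing.
set N := (fun a b => _) in planN; have [N0 Nmissing Nfreed] := planN.
exists (fun a b => M a b * kept a + N a b).
  split=> [a b|a|b].
  - by rewrite addr_ge0// mulr_ge0//; case/andP: (kept01 a).
  - by rewrite big_split/= -mulr_suml Mu Nmissing u_kept /missing addrC subrK.
  - rewrite big_split/= Nfreed -big_split/= -Mv; apply: eq_bigr => a _.
    by rewrite -mulrDr addrC subrK mulr1.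
rewrite plan_costD lerD//.
  apply: ler_sum => a _; apply: ler_sum => b _; rewrite ler_wpM2r//.
  by rewrite ler_piMr//; case/andP: (kept01 a).
apply: le_trans (plan_cost_le_total planN DDmax) _; rewrite ler_wpM2l//.
apply: ler_sum => a _; rewrite /missing /overlap.
by case: (leP (u a)) => _; rewrite ?subrr// distrC ler_norm.
Qed.

End Plans.

Lemma transport_plan_tr (I K : finType) (u : I -> R) (v : K -> R) M :
  transport_plan u v M -> transport_plan v u (fun b a => M a b).
Proof. by case. Qed.

Lemma plan_cost_tr (I K : finType) (D M : I -> K -> R) :
  plan_cost (fun b a => D a b) (fun b a => M a b) = plan_cost D M.
Proof. exact: exchange_big. Qed.

Lemma transport_plan_perturb (I K : finType) (D M : I -> K -> R)
    (u u' : I -> R) (v v' : K -> R) (Dmax : R) :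
  transport_plan u v M ->
  (forall a, 0 <= u' a) -> (forall b, 0 <= v' b) ->
  \sum_a u' a = \sum_a u a -> \sum_b v' b = \sum_b v b ->
  (forall a b, 0 <= D a b) -> (forall a b, D a b <= Dmax) -> 0 <= Dmax ->
  exists2 M', transport_plan u' v' M' &
    plan_cost D M' <= plan_cost D M +
      Dmax * (\sum_a `|u a - u' a| + \sum_b `|v b - v' b|).
Proof.
move=> planM u'0 v'0 totalu totalv D0 DDmax Dmax0.
have [M' planM' costM'] :=
  transport_plan_perturb_rows planM u'0 totalu D0 DDmax Dmax0.
have [M'' planM'' costM''] := transport_plan_perturb_rows
  (transport_plan_tr planM') v'0 totalv (fun b a => D0 a b)
  (fun b a => DDmax a b) Dmax0.
exists (fun a b => M'' b a); first exact: transport_plan_tr.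
rewrite -plan_cost_tr (le_trans costM'')// plan_cost_tr mulrDr addrA.
by rewrite lerD2r.
Qed.

End TransportPlans.

(** * Couplings *)

Section Couplings.
Context {R : realType} {d : measure_display} {X : measurableType d}.
Implicit Types (mu nu : probability X R) (pi : probability (X * X)%type R).

Lemma coupling_integral_fst mu nu pi (f : X -> \bar R) : coupling mu nu pi ->
  measurable_fun setT f -> (forall x, 0 <= f x)%E ->
  (\int[pi]_z f z.1 = \int[mu]_x f x)%E.
Proof.
move=> cpl; apply: ge0_integral_law => // A mA.
rewrite -[RHS](proj1 (cpl A mA)); congr (pi _).
by apply/seteqP; split => [z|z []].
Qed.

Lemma coupling_integral_snd mu nu pi (f : X -> \bar R) : coupling mu nu pi ->
  measurable_fun setT f -> (forall x, 0 <= f x)%E ->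
  (\int[pi]_z f z.2 = \int[nu]_x f x)%E.
Proof.
move=> cpl; apply: ge0_integral_law => // A mA.
rewrite -[RHS](proj2 (cpl A mA)); congr (pi _).
by apply/seteqP; split => [z|z []].
Qed.

Lemma coupling_integral_le mu nu pi (e : X -> R) (f g : X * X -> R) :
  coupling mu nu pi ->
  measurable_fun setT e -> measurable_fun setT f -> measurable_fun setT g ->
  (forall x, 0 <= e x) -> (forall z, 0 <= f z) -> (forall z, 0 <= g z) ->
  (forall z, f z <= e z.1 + g z + e z.2) ->
  (\int[pi]_z (f z)%:E <=
   \int[mu]_x (e x)%:E + \int[pi]_z (g z)%:E + \int[nu]_x (e x)%:E)%E.
Proof.
move=> cpl /measurable_EFinP me /measurable_EFinP mf /measurable_EFinP mg.
move=> e_ge0 f_ge0 g_ge0 fle.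
have e0 x : (0 <= (e x)%:E)%E by rewrite lee_fin.
have f0 z : (0 <= (f z)%:E)%E by rewrite lee_fin.
have g0 z : (0 <= (g z)%:E)%E by rewrite lee_fin.
have me1 : measurable_fun setT (fun z : X * X => (e z.1)%:E).
  exact: (measurableT_comp me).
have me2 : measurable_fun setT (fun z : X * X => (e z.2)%:E).
  exact: (measurableT_comp me).
have me1g : measurable_fun setT (fun z : X * X => (e z.1)%:E + (g z)%:E)%E.
  exact: emeasurable_funD.
apply: (@le_trans _ _
    (\int[pi]_z ((e z.1)%:E + (g z)%:E + (e z.2)%:E))%E).
  apply: ge0_le_integral => //; first exact: emeasurable_funD.
  by move=> z _; rewrite -!EFinD lee_fin.
rewrite ge0_integralD//; last by move=> z _; rewrite adde_ge0.
rewrite ge0_integralD// (coupling_integral_fst (f := EFin \o e) cpl)//.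
by rewrite (coupling_integral_snd (f := EFin \o e) cpl).
Qed.

Lemma coupling_product mu nu : coupling mu nu (mu \x nu)%E.
Proof.
move=> A mA; split.
  by rewrite [LHS]product_measure1E// -[RHS]mule1 -(probability_setT nu).
by rewrite [LHS]product_measure1E// -[RHS]mul1e -(probability_setT mu).
Qed.

Lemma coupling_mixture (K : finType) (lam : K -> R) (lamP : convex_weights lam)
    (mus nus : K -> probability X R) (pis : K -> probability (X * X)%type R) :
  (forall i, coupling (mus i) (nus i) (pis i)) ->
  coupling (mixture_prob lamP mus) (mixture_prob lamP nus)
    (mixture_prob lamP pis).
Proof.
move=> cpl A mA; rewrite !mixture_probE; split; apply: eq_bigr => i _.
  by rewrite (proj1 (cpl i A mA)).
by rewrite (proj2 (cpl i A mA)).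
Qed.

Section CellCouplings.
Context {I : finType} (idx : X -> I).
Hypothesis measurable_cell : forall a, measurable (cell idx a).

Definition pair_idx (z : X * X) : I * I := (idx z.1, idx z.2).

Lemma cell_pair a b : cell pair_idx (a, b) = cell idx a `*` cell idx b.
Proof.
by apply/seteqP; split => z /=; rewrite /cell /=; [case|case=> <- <-].
Qed.

Lemma measurable_cell_pair c : measurable (cell pair_idx c).
Proof. by case: c => a b; rewrite cell_pair; exact: measurableX. Qed.

Definition coupling_plan pi (a b : I) : R := cell_mass pair_idx pi (a, b).

Lemma coupling_planP mu nu pi : coupling mu nu pi ->
  transport_plan (cell_mass idx mu) (cell_mass idx nu) (coupling_plan pi).
Proof.
move=> cpl.
have cell_fst a : cell (idx \o fst) a = cell idx a `*` [set: X].
  by apply/seteqP; split => [z|z []].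
have cell_snd b : cell (idx \o snd) b = [set: X] `*` cell idx b.
  by apply/seteqP; split => [z|z []].
have mfst a : measurable (cell (idx \o fst) a : set (X * X)).
  by rewrite cell_fst; exact: measurableX.
have msnd b : measurable (cell (idx \o snd) b : set (X * X)).
  by rewrite cell_snd; exact: measurableX.
have cell_pairI a b :
    cell pair_idx (a, b) = cell (idx \o fst) a `&` cell (idx \o snd) b.
  by rewrite cell_pair; apply/seteqP; split => z [].
split=> [a b|a|b]; first exact: cell_mass_ge0.
- rewrite [RHS]/cell_mass -(proj1 (cpl _ (measurable_cell a))) -cell_fst.
  rewrite -(sum_fine_measure_cells msnd)//.
  by apply: eq_bigr => b _; rewrite -cell_pairI.
- rewrite [RHS]/cell_mass -(proj2 (cpl _ (measurable_cell b))) -cell_snd.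
  rewrite -(sum_fine_measure_cells mfst)//.
  by apply: eq_bigr => a _; rewrite setIC -cell_pairI.
Qed.

Lemma integral_coupling_plan pi (D : I -> I -> R) : (forall a b, 0 <= D a b) ->
  (\int[pi]_z (D (idx z.1) (idx z.2))%:E =
   (plan_cost D (coupling_plan pi))%:E)%E.
Proof.
move=> D0; pose F (c : I * I) := D c.1 c.2.
rewrite -[LHS]/(\int[pi]_z (F (pair_idx z))%:E)%E.
rewrite (integral_cells measurable_cell_pair)/=; last by move=> c; exact: D0.
rewrite /plan_cost pair_bigA; congr EFin.
by apply: eq_bigr => -[a b] _; rewrite mulrC.
Qed.

Section BlockCoupling.
Variables (mu nu : probability X R) (M : I -> I -> R).
Hypothesis planM : transport_plan (cell_mass idx mu) (cell_mass idx nu) M.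

Let M_ge0 a b : 0 <= M a b. Proof. by case: planM. Qed.

Let convex_weights_plan : convex_weights (fun c : I * I => M c.1 c.2).
Proof.
split=> [c|]; first exact: M_ge0.
rewrite -(pair_bigA _ (fun a b => M a b))/= -(sum_cell_mass measurable_cell mu).
by apply: eq_bigr => a _; case: planM.
Qed.

Definition block_coupling : probability (X * X)%type R :=
  mixture_prob convex_weights_plan (fun c =>
    (cell_prob measurable_cell mu c.1 \x cell_prob measurable_cell nu c.2)%E).

Let block_couplingX A B : measurable A -> measurable B ->
  block_coupling (A `*` B) = (\sum_a \sum_b (M a b)%:E *
    (cell_prob measurable_cell mu a A * cell_prob measurable_cell nu b B))%E.
Proof.
move=> mA mB; rewrite [LHS]mixture_probE pair_bigA/=.
by apply: eq_bigr => c _; rewrite product_measure1E.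
Qed.

Lemma coupling_block : coupling mu nu block_coupling.
Proof.
have [_ Mmu Mnu] := planM; move=> A mA; split.
- rewrite block_couplingX// (measure_cells measurable_cell mu mA).
  apply: eq_bigr => a _; rewrite -(cond_probE _ (measurable_cell a))//.
  rewrite -EFin_cell_mass// -Mmu -sumEFin.
  rewrite ge0_sume_distrl => [|b _]; last by rewrite lee_fin.
  by apply: eq_bigr => b _; rewrite [cell_prob _ nu b _]probability_setT mule1.
- rewrite block_couplingX// exchange_big (measure_cells measurable_cell nu mA).
  apply: eq_bigr => b _; rewrite -(cond_probE _ (measurable_cell b))//.
  rewrite -EFin_cell_mass// -Mnu -sumEFin.
  rewrite ge0_sume_distrl => [|a _]; last by rewrite lee_fin.
  by apply: eq_bigr => a _; rewrite [cell_prob _ mu a _]probability_setT mul1e.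
Qed.

Lemma coupling_plan_block : coupling_plan block_coupling = M.
Proof.
have [_ Mmu Mnu] := planM; apply/funext => a; apply/funext => b.
apply: EFin_inj; rewrite EFin_cell_mass; last exact: measurable_cell_pair.
rewrite cell_pair block_couplingX//.
have block_cell a' b' : ((M a' b')%:E *
    (cell_prob measurable_cell mu a' (cell idx a) *
     cell_prob measurable_cell nu b' (cell idx b)) =
    (M a' b' * ((a' == a) && (b' == b))%:R)%:E)%E.
  have [->|Mab'] := eqVneq (M a' b') 0; first by rewrite mul0e mul0r.
  rewrite !cell_prob_cell -?EFinM -?natrM ?mulnb//; apply: contra_neq Mab'.
    by rewrite -Mnu => col0; exact: (psumr_eq0P _ col0).
  by rewrite -Mmu => row0; exact: (psumr_eq0P _ row0).
under eq_bigr do under eq_bigr do rewrite block_cell.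
rewrite (bigD1 a)//= (bigD1 b)//= !eqxx mulr1 !big1 ?adde0// => [a' a'a|b' b'b].
  by rewrite big1// => b' _; rewrite (negPf a'a) mulr0.
by rewrite (negPf b'b) mulr0.
Qed.

End BlockCoupling.
End CellCouplings.
End Couplings.

(** * Strong convexity of the entropy *)

Section Entropy.
Context {R : realType}.

(* Square roots turn ln t <= t - 1 into the Hellinger-type gain
   (sqrt x - sqrt m)^2 over the tangent line of x ln x at m. *)
Lemma xlogx_ge_tangent (x m : R) : 0 <= x <= 1 -> 0 < m <= 1 ->
  x * ln m + (x - m) + (x - m) ^+ 2 / 4 <= xlogx x.
Proof.
move=> /andP[x0 x1] /andP[m0 m1]; rewrite /xlogx; case: eqP => [->|xn0].
  by nra.
have {x0 xn0}xp : 0 < x by rewrite lt_def x0 andbT; exact/eqP.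
set a := Num.sqrt x; set b := Num.sqrt m.
have a0 : 0 < a by rewrite sqrtr_gt0.
have b0 : 0 < b by rewrite sqrtr_gt0.
have a1 : a <= 1 by rewrite -(sqrtr1 R) ler_sqrt.
have b1 : b <= 1 by rewrite -(sqrtr1 R) ler_sqrt.
have xE : x = a * a by rewrite -expr2 sqr_sqrtr// ltW.
have mE : m = b * b by rewrite -expr2 sqr_sqrtr// ltW.
have ln_ratio : ln b - ln a <= b / a - 1.
  rewrite -ln_div ?posrE//.
  have := @le_ln1Dx R (b / a - 1); rewrite [1 + _]addrC subrK; apply.
  by rewrite ltrBrDl subrr divr_gt0.
have ln_gap : a * (ln b - ln a) <= b - a.
  apply: le_trans (ler_wpM2l (ltW a0) ln_ratio) _.
  by rewrite mulrBr mulr1 mulrCA divff ?gt_eqF// mulr1.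
have hellinger_gain : x * ln m + (x - m) + (a - b) ^+ 2 <= x * ln x.
  rewrite [in ln x]xE [in ln m]mE !lnM ?posrE// xE mE.
  have : a * (a * (ln b - ln a)) <= a * (b - a) by rewrite ler_wpM2l// ltW.
  by nra.
apply: le_trans hellinger_gain; rewrite lerD2l xE mE.
rewrite (_ : _ / 4 = (a - b) ^+ 2 * ((a + b) ^+ 2 / 4)); last by field.
by rewrite ler_piMr ?sqr_ge0//; nra.
Qed.

Lemma xlogx_midpoint (x y : R) : 0 <= x <= 1 -> 0 <= y <= 1 ->
  2 * xlogx ((x + y) / 2) + (x - y) ^+ 2 / 8 <= xlogx x + xlogx y.
Proof.
move=> x01 y01; have [/andP[x0 x1] /andP[y0 y1]] := (x01, y01).
have [m0|m0] := eqVneq ((x + y) / 2) 0.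
  have [-> ->] : x = 0 /\ y = 0 by split; lra.
  by rewrite addr0 mul0r subrr expr0n/= mul0r addr0 /xlogx eqxx mulr0 addr0.
have mp : 0 < (x + y) / 2 <= 1 by rewrite lt_def m0 /=; lra.
have := xlogx_ge_tangent x01 mp; have := xlogx_ge_tangent y01 mp.
have -> : xlogx ((x + y) / 2) = (x + y) / 2 * ln ((x + y) / 2).
  by rewrite {1}/xlogx (negPf m0).
by set l := ln _; nra.
Qed.

Lemma sum_xlogx_midpoint (I : finType) (l l' : I -> R) :
  (forall i, 0 <= l i <= 1) -> (forall i, 0 <= l' i <= 1) ->
  2 * \sum_i xlogx ((l i + l' i) / 2) + (\sum_i (l i - l' i) ^+ 2) / 8 <=
  \sum_i xlogx (l i) + \sum_i xlogx (l' i).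
Proof.
move=> l01 l'01; rewrite mulr_sumr mulr_suml -!big_split/=.
by apply: ler_sum => i _; exact: xlogx_midpoint.
Qed.

End Entropy.

(** * Perturbation of minimizers over the simplex *)

Definition simplex_close {R : realType} J (Q Q' : ('I_J -> R) -> \bar R)
    (e : R) :=
  forall l, simplex l -> (Q l <= Q' l + e%:E)%E /\ (Q' l <= Q l + e%:E)%E.

Lemma argmin_perturbation (R : realType) J (Q Q' : ('I_J -> R) -> \bar R)
    (e : R) l l' :
  is_argmin Q l -> is_argmin Q' l' -> simplex_close Q Q' e ->
  (Q l' <= Q l + (2 * e)%:E)%E.
Proof.
move=> [lP _] [l'P Q'min] close.
apply: (le_trans (proj1 (close _ l'P))).
rewrite mulr_natl mulr2n EFinD addeA leeD2r//.
exact: le_trans (Q'min _ lP) (proj2 (close _ lP)).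
Qed.

Lemma sqr_sum_norm_le (R : realFieldType) (I : finType) (z : I -> R) :
  (\sum_i `|z i|) ^+ 2 <= #|I|%:R * \sum_i z i ^+ 2.
Proof.
rewrite expr2 big_distrlr/=.
apply: (@le_trans _ _ (\sum_i \sum_j (z i ^+ 2 + z j ^+ 2) / 2)).
  apply: ler_sum => i _; apply: ler_sum => j _.
  rewrite -(real_normK (num_real (z i))) -(real_normK (num_real (z j))).
  by have := sqr_ge0 (`|z i| - `|z j|); lra.
have -> : \sum_i \sum_j (z i ^+ 2 + z j ^+ 2) / 2 =
    (\sum_i \sum_(j : I) z i ^+ 2 + \sum_(i : I) \sum_j z j ^+ 2) / 2.
  rewrite -big_split mulr_suml; apply: eq_bigr => i _.
  by rewrite -big_split mulr_suml.
by rewrite exchange_big/= sumr_const mulrDl -splitr mulr_natl.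
Qed.

(** * Concentration of empirical measures *)

Section OuterProbability.
Context {R : realType} {d : measure_display} {T : measurableType d}.
Variable P : probability T R.
Implicit Types (E : set T) (kappa : R).

Definition outer_prob_le E kappa :=
  exists2 B : set T, measurable B /\ E `<=` B & (P B <= kappa%:E)%E.

Lemma outer_prob_leS E E' kappa kappa' : E `<=` E' -> kappa' <= kappa ->
  outer_prob_le E' kappa' -> outer_prob_le E kappa.
Proof.
move=> EE' kk [B [mB E'B] PB]; exists B.
  by split=> //; exact: subset_trans E'B.
by rewrite (le_trans PB)// lee_fin.
Qed.

Lemma outer_prob_leU E E' kappa kappa' :
  outer_prob_le E kappa -> outer_prob_le E' kappa' ->
  outer_prob_le (E `|` E') (kappa + kappa').
Proof.
move=> [B [mB EB] PB] [B' [mB' EB'] PB']; exists (B `|` B').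
  by split; [exact: measurableU|exact: setUSS].
by rewrite EFinD (le_trans (measureU2 _ mB mB'))// leeD.
Qed.

Lemma outer_prob_le_bigcup (I : finType) (E : I -> set T) (kappa : I -> R) :
  (forall i, outer_prob_le (E i) (kappa i)) ->
  outer_prob_le (\bigcup_i E i) (\sum_i kappa i).
Proof.
move=> Ekappa; rewrite (_ : \bigcup_i E i = \big[setU/set0]_i E i).
  elim/big_ind2: _ => [|E1 k1 E2 k2|i _] //; last exact: outer_prob_leU.
  by exists set0; [split|rewrite measure0].
rewrite -bigcup_seq; apply/seteqP; split => x [i _ Ei]; exists i => //=.
exact: mem_index_enum.
Qed.

Lemma markov_outer_prob (g : T -> R) (t kappa : R) :
  measurable_fun setT g -> (forall x, 0 <= g x) -> 0 < t ->
  (\int[P]_x (g x)%:E <= (t * kappa)%:E)%E ->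
  outer_prob_le [set x | t < g x] kappa.
Proof.
move=> /measurable_EFinP mg g0 t0 intg.
exists [set x | (t%:E <= `|(g x)%:E|)%E].
  split; last by move=> x /= /ltW tg; rewrite lee_fin ger0_norm.
  rewrite -[X in measurable X]setTI.
  by apply: emeasurable_fun_c_infty => //; exact: measurableT_comp.
rewrite -(@lee_pmul2l _ t%:E)// -EFinM; apply: le_trans intg.
have := @le_integral_comp_abse _ _ _ P _ measurableT _ t id
  (@measurable_id _ _ _) (fun _ => id) (fun _ _ _ _ => id) mg t0.
rewrite setTI => /le_trans; apply.
by rewrite (eq_integral (EFin \o g)) => // x _ /=; rewrite ger0_norm.
Qed.

Lemma indic_Lfun (A : set T) (r : R) : measurable A -> 0 < r ->
  (\1_A : T -> R) \in Lfun P r%:E.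
Proof.
move=> mA r0; rewrite inE; apply/andP; split; rewrite inE/=.
  exact: measurable_indic.
rewrite /finite_norm unlock poweR_lty//.
rewrite (eq_integral (EFin \o \1_A)) => [|x _ /=].
  by rewrite integral_indic// setIT ltey_eq fin_num_measure.
rewrite indicE; case: (x \in A); rewrite ?normr1 ?normr0 ?powR1//.
by rewrite powR0 ?gt_eqF.
Qed.

Lemma covariance_indic (A B : set T) : measurable A -> measurable B ->
  (covariance P \1_A \1_B = P (A `&` B) - P A * P B)%E.
Proof.
move=> mA mB.
have indicM : (\1_A * \1_B : T -> R) = \1_(A `&` B) by rewrite indicI.
rewrite covarianceE ?indicM ?indic_Lfun//; last exact: measurableI.
by rewrite !expectation_indic//; exact: measurableI.
Qed.

Section UncorrelatedSums.
Variables (Z : nat -> T -> R) (m v : R).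
Hypothesis Z_L2 : forall k, Z k \in Lfun P 2%:E.
Hypothesis Z_uncorrelated :
  forall k l, k != l -> covariance P (Z k) (Z l) = 0%E.

Let sum_L2 n : \sum_(k < n) Z k \in Lfun P 2%:E.
Proof. by rewrite rpred_sum ?lee1n. Qed.

Lemma variance_sum_uncorrelated n :
  ('V_P[(\sum_(k < n) Z k)%R] = \sum_(k < n) 'V_P[Z k])%E.
Proof.
have sum_cov q l : (q <= l)%N -> covariance P (\sum_(k < q) Z k) (Z l) = 0%E.
  elim: q => [|q IHq] ql; first by rewrite big_ord0 covariance_cst_l.
  rewrite big_ord_recr covarianceDl// IHq ?(ltnW ql)// Z_uncorrelated ?adde0//.
  by rewrite neq_ltn ql.
elim: n => [|n IHn]; first by rewrite !big_ord0 variance_cst.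
by rewrite !big_ord_recr (varianceD (sum_L2 n))// IHn sum_cov// mule0 adde0.
Qed.

Hypothesis Z_mean : forall k, ('E_P[Z k] = m%:E)%E.
Hypothesis Z_variance : forall k, ('V_P[Z k] <= v%:E)%E.

Lemma mean_deviation_uncorrelated n (c : R) : (0 < n)%N -> 0 < c ->
  outer_prob_le [set x | c < `|(\sum_(k < n) Z k x) / n%:R - m|]
    (v / (c ^+ 2 * n%:R)).
Proof.
rewrite -(ltr0n R) => n0 c0; pose S : T -> R := \sum_(k < n) Z k.
have S2 : S \in Lfun P 2%:E := sum_L2 n.
have ES : fine ('E_P[S])%E = n%:R * m.
  rewrite /S -(big_map _ xpredT (fun f : T -> R => f)) expectation_sum.
    rewrite big_map (eq_bigr (fun=> m%:E)) => [|k _]; last exact: Z_mean.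
    by rewrite sumEFin sumr_const card_ord mulr_natl.
  move=> f /mapP[k _ ->].
  by apply: Lfun_subset12 (Z_L2 k); rewrite fin_num_measure.
have VS : ('V_P[S] <= (n%:R * v)%:E)%E.
  rewrite variance_sum_uncorrelated// mulr_natl -[n in v *+ n]card_ord.
  by rewrite -sumr_const -sumEFin; apply: lee_sum.
have cheb : (P [set x | (c * n%:R <= `|S x - fine 'E_P[S]|)%R] <=
    ((c * n%:R) ^- 2)%:E * 'V_P[S])%E.
  exact: (chebyshev (mfun_Sub (sub_Lfun_mfun S2)) (mulr_gt0 c0 n0)).
exists [set x | c * n%:R <= `|S x - fine ('E_P[S])%E|].
  split=> [|x /= /ltW cx].
    have mS : measurable_fun setT S by have := sub_Lfun_mfun S2; rewrite inE.
    have mdev : measurable_fun setT (fun x => `|S x - fine ('E_P[S])%E|).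
      by apply: measurableT_comp => //; exact: measurable_funB.
    have := measurable_fun_ler (measurable_cst (c * n%:R)) mdev measurableT.
    by move=> /(_ [set true] I); rewrite setTI.
  rewrite ES /S fct_sumE.
  rewrite (_ : _ - _ = ((\sum_(k < n) Z k x) / n%:R - m) * n%:R).
    by rewrite normrM (gtr0_norm n0) ler_pM2r.
  by rewrite mulrBl divfK ?gt_eqF// (mulrC m).
apply: (le_trans cheb).
apply: (le_trans (lee_wpmul2l _ VS)); first by rewrite lee_fin invr_ge0 sqr_ge0.
rewrite -EFinM lee_fin [leLHS](_ : _ = v / (c ^+ 2 * n%:R))//.
by field; rewrite !gt_eqF.
Qed.

Lemma weak_law_uncorrelated (c kappa : R) : 0 < c -> 0 < kappa ->
  \forall n \near \oo,
    outer_prob_le [set x | c < `|(\sum_(k < n) Z k x) / n%:R - m|] kappa.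
Proof.
move=> c0 kappa0; near=> n.
have n0 : (0 < n)%N by near: n; exact: nbhs_infty_gt.
apply: (outer_prob_leS _ _ (mean_deviation_uncorrelated n0 c0)) => //.
rewrite ler_pdivrMr ?mulr_gt0 ?exprn_gt0 ?ltr0n// mulrA.
rewrite -ler_pdivrMl ?mulr_gt0 ?exprn_gt0//.
by near: n; exact: nbhs_infty_ger.
Unshelve. all: by end_near. Qed.

End UncorrelatedSums.
End OuterProbability.

Section EmpiricalMeasure.
Context {R : realType} {d : measure_display} {X : measurableType d}.
Context {T : Type} (Z : nat -> T -> X).

Lemma convex_weights_uniform N : (0 < N)%N ->
  convex_weights (fun _ : 'I_N => N%:R^-1 : R).
Proof.
move=> N0; split=> [//|].
by rewrite sumr_const card_ord -[_ *+ N]mulr_natr mulVf// pnatr_eq0 -lt0n.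
Qed.

Definition empirical_prob N (N_gt0 : (0 < N)%N) (w : T) : probability X R :=
  mixture_prob (convex_weights_uniform N_gt0)
    (fun k : 'I_N => \d_(Z k w) : probability X R).

Lemma empirical_empirical_prob N (N_gt0 : (0 < N)%N) w :
  empirical N Z w = empirical_prob N_gt0 w :> (set X -> \bar R).
Proof.
by apply/funext => A; rewrite mixture_probE /empirical ge0_sume_distrr.
Qed.

Lemma integral_empirical N w (f : X -> R) : (0 < N)%N ->
  measurable_fun setT f -> (forall x, 0 <= f x) ->
  (\int[empirical N Z w]_x (f x)%:E = ((\sum_(k < N) f (Z k w)) / N%:R)%:E)%E.
Proof.
move=> N0 /measurable_EFinP mf f0; rewrite (empirical_empirical_prob N0).
rewrite integral_mixture_prob//.
rewrite mulr_suml -sumEFin; apply: eq_bigr => k _.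
by rewrite integral_dirac// diracT mul1e -EFinM mulrC.
Qed.

Lemma cell_mass_empirical (I : finType) (idx : X -> I) N w a :
  cell_mass idx (empirical N Z w : set X -> \bar R) a =
  (\sum_(k < N) \1_(Z k @^-1` cell idx a) w) / N%:R.
Proof.
rewrite /cell_mass /empirical.
rewrite (eq_bigr (fun k : 'I_N => (\1_(Z k @^-1` cell idx a) w)%:E)).
  by rewrite sumEFin -EFinM /= mulrC.
by move=> k _; rewrite diracE indicE.
Qed.

End EmpiricalMeasure.

Section IidSample.
Context {R : realType} {d : measure_display} {X : measurableType d}.
Context {d' : measure_display} {Omega : measurableType d'}.
Variables (Pr : probability Omega R) (Z : nat -> Omega -> X).
Variable P : probability X R.
Hypothesis Z_iid : iid_with_law Pr Z P.

Lemma measurable_sample_event k A : measurable A -> measurable (Z k @^-1` A).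
Proof.
case: Z_iid => mZ _ _ mA; rewrite -[X in measurable X]setTI; exact: mZ.
Qed.

Lemma sample_pair_independent k l A B :
  measurable A -> measurable B -> k != l ->
  Pr (Z k @^-1` A `&` Z l @^-1` B) = (P A * P B)%E.
Proof.
move=> mA mB kl; have [_ lawZ indZ] := Z_iid; rewrite -(lawZ k)// -(lawZ l)//.
have := indZ [:: k; l] (fun i => if i == k then A else B).
rewrite /= inE kl => /(_ isT) indkl.
transitivity (\prod_(i <- [:: k; l])
    Pr (Z i @^-1` (if i == k then A else B)))%E; last first.
  by rewrite !big_cons big_nil mule1 eqxx eq_sym (negPf kl).
rewrite -indkl => [|i]; last by case: ifP.
congr (Pr _); apply/seteqP; split => [w [wk wl] i /=|w wkl].
  by rewrite !inE => /orP[]/eqP ->; rewrite ?eqxx// eq_sym (negPf kl).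
have := wkl k; have := wkl l; rewrite /= !inE !eqxx orbT eq_sym (negPf kl).
by move=> /(_ isT) wl /(_ isT) wk.
Qed.

Lemma sample_mean_outer_prob (f : X -> R) (t kappa : R) N : (0 < N)%N ->
  measurable_fun setT f -> (forall x, 0 <= f x) -> 0 < t ->
  (\int[P]_x (f x)%:E <= (t * kappa)%:E)%E ->
  outer_prob_le Pr [set w | t < (\sum_(k < N) f (Z k w)) / N%:R] kappa.
Proof.
move=> N0 mf f0 t0 intf; have [mZ lawZ _] := Z_iid.
have mfZ k : measurable_fun setT (fun w => f (Z k w)).
  exact: measurableT_comp.
apply: markov_outer_prob => //.
- by apply: measurable_funM => //; exact: measurable_sum.
- by move=> w; rewrite divr_ge0// sumr_ge0.
under eq_integral do rewrite mulrC EFinM -sumEFin.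
rewrite ge0_integralZl//; last 2 first.
- by apply: emeasurable_sum => k; exact/measurable_EFinP.
- by move=> w _; apply: sume_ge0 => k _; rewrite lee_fin.
rewrite ge0_integral_sum//; last 2 first.
- by move=> k; exact/measurable_EFinP.
- by move=> k w _; rewrite lee_fin.
rewrite (eq_bigr (fun=> \int[P]_x (f x)%:E)%E) => [|k _]; last first.
  apply: (ge0_integral_law (f := EFin \o f) (mZ k) (lawZ k)) => //.
  exact/measurable_EFinP.
have int_fin : (\int[P]_x (f x)%:E)%E \is a fin_num.
  rewrite ge0_fin_numE ?(le_lt_trans intf) ?ltry//.
  by apply: integral_ge0 => x _; rewrite lee_fin.
apply: le_trans intf; rewrite -(fineK int_fin) sumEFin -EFinM lee_fin.
rewrite sumr_const card_ord -[X in _ * X <= _]mulr_natr mulrCA mulVf ?mulr1//.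
by rewrite pnatr_eq0 -lt0n.
Qed.

Lemma sample_frequency_concentration A (c kappa : R) : measurable A ->
  0 < c -> 0 < kappa ->
  \forall N \near \oo, outer_prob_le Pr [set w | c <
    `|(\sum_(k < N) \1_(Z k @^-1` A) w) / N%:R - fine (P A)|] kappa.
Proof.
move=> mA c0 kappa0; have [mZ lawZ _] := Z_iid.
have mZA k : measurable (Z k @^-1` A) := measurable_sample_event k mA.
have PA : P A = (fine (P A))%:E by rewrite fineK// fin_num_measure.
have PA01 : 0 <= fine (P A) <= 1.
  by rewrite fine_ge0//= -lee_fin -PA probability_le1.
apply: (weak_law_uncorrelated (Z := fun k => \1_(Z k @^-1` A)) (v := 1))
  => // [k|k l kl|k|k].
- exact: indic_Lfun.
- by rewrite covariance_indic// sample_pair_independent// !lawZ// PA subee.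
- by rewrite expectation_indic// lawZ.
- rewrite /variance covariance_indic// setIid !lawZ// PA -EFinM -EFinB lee_fin.
  by nra.
Qed.

End IidSample.

(** * Quantization and stability of the Wasserstein distance *)

Lemma measurable_fun_sublevel {R : realType} {d : measure_display}
    {T : measurableType d} (f : T -> R) :
  (forall r, measurable [set x | f x < r]) -> measurable_fun setT f.
Proof.
move=> mf; apply: (measurability _ (RGenInftyO.measurableE R)).
by move=> _ [_ [r ->] <-]; rewrite setTI; exact: mf.
Qed.

Lemma measurable_sublevel {R : realType} {d : measure_display}
    {T : measurableType d} (f : T -> R) r :
  measurable_fun setT f -> measurable [set x | f x < r].
Proof.
move=> mf; have := measurable_fun_ltr mf (measurable_cst r) measurableT.
by move=> /(_ [set true] I); rewrite setTI.
Qed.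

Lemma cvg_integral_vanishing_sets {R : realType} {d : measure_display}
    {T : measurableType d} (mu : {measure set T -> \bar R})
    (F : nat -> set T) (f : T -> R) :
  (forall n, measurable (F n)) -> measurable_fun setT f ->
  (forall x, 0 <= f x) -> (\int[mu]_x (f x)%:E < +oo)%E ->
  (forall x, \forall n \near \oo, ~ F n x) ->
  (\int[mu]_(x in F n) (f x)%:E @[n --> \oo] --> 0)%E.
Proof.
move=> mF /measurable_EFinP mf f0 foo Fx; rewrite -(integral0 mu setT).
under eq_fun do rewrite integral_mkcond.
apply: (dominated_cvg measurableT (g := EFin \o f)) => //.
- move=> n; apply/(measurable_restrictT _ _).1 => //.
  exact: measurable_funS mf.
- move=> x _; apply: cvg_near_cst; near=> n.
  by rewrite patchE memNset//; near: n.
- apply/integrableP; split=> //; rewrite (eq_integral (EFin \o f))// => x _.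
  by rewrite gee0_abs// lee_fin.
- move=> n x _; rewrite patchE; case: ifP => _; last by rewrite abse0 lee_fin.
  by rewrite gee0_abs// lee_fin.
Unshelve. all: by end_near. Qed.

Section Wasserstein.
Context {R : realType} {d : measure_display} {X : measurableType d}.
Variable dist : X -> X -> R.
Hypothesis dist_metric : is_metric dist.
Hypothesis dist_separable : metric_separable dist.
Hypothesis dist_borel : @measurable _ X = <<s metric_open dist >>.
Implicit Types (mu nu : probability X R) (pi : probability (X * X)%type R).

Lemma metric_sym x y : dist x y = dist y x.
Proof. by case: dist_metric => _ ->. Qed.

Lemma metric_triangle y x z : dist x z <= dist x y + dist y z.
Proof. by case: dist_metric => _ _ ->. Qed.

Lemma metric_ge0 x y : 0 <= dist x y.
Proof.
have distxx : dist x x = 0 by case: dist_metric => /(_ x x)[_ ->].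
have := metric_triangle y x x; rewrite distxx (metric_sym y x).
by rewrite -mulr2n pmulrn_lge0.
Qed.

#[local] Hint Resolve metric_ge0 : core.

Lemma measurable_dist_from x : measurable_fun setT (dist x).
Proof.
apply: measurable_fun_sublevel => r; rewrite dist_borel.
apply: sub_sigma_algebra => y /= xy.
exists (r - dist x y); first by rewrite subr_gt0.
move=> z /= yz; rewrite (le_lt_trans (metric_triangle y x z))//.
by rewrite -ltrBrDl.
Qed.

(* Separability makes dist measurable for the product sigma-algebra, which in
   general is smaller than the Borel one: dist x y < r iff some point of the
   dense sequence witnesses it through the triangle inequality. *)
Lemma measurable_dist : measurable_fun setT (fun z : X * X => dist z.1 z.2).
Proof.
case: dist_separable => [/(_ point)//|[s sd]].
apply: measurable_fun_sublevel => r.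
rewrite (_ : mkset _ =
  \bigcup_n [set z | dist (s n) z.1 + dist (s n) z.2 < r]).
  apply: bigcupT_measurable => n; apply: measurable_sublevel.
  by apply: measurable_funD; apply: measurableT_comp => //;
    exact: measurable_dist_from.
apply/seteqP; split => [z /= zr|z [n _ /=]]; last first.
  by apply: le_lt_trans; rewrite (metric_sym (s n) z.1) metric_triangle.
have e0 : 0 < (r - dist z.1 z.2) / 2 by rewrite divr_gt0// subr_gt0.
have [n zn] := sd z.1 _ e0; exists n => //=.
by have := metric_triangle z.1 (s n) z.2; rewrite (metric_sym (s n) z.1); lra.
Qed.

Lemma measurable_dist_comp d' (T : measurableType d') (f g : T -> X) :
  measurable_fun setT f -> measurable_fun setT g ->
  measurable_fun setT (fun x => dist (f x) (g x)).
Proof.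
move=> mf mg.
exact: measurableT_comp measurable_dist (measurable_fun_pair mf mg).
Qed.

Definition transport_cost pi : \bar R := (\int[pi]_z (dist z.1 z.2)%:E)%E.

Lemma W1_ge0 (mu nu : set X -> \bar R) : (0 <= W1 dist mu nu)%E.
Proof.
apply: le_ereal_inf_tmp => _ [pi _ <-].
by apply: integral_ge0 => z _; rewrite lee_fin.
Qed.

Lemma W1_le_cost (mu nu : set X -> \bar R) pi : coupling mu nu pi ->
  (W1 dist mu nu <= transport_cost pi)%E.
Proof. by move=> cpl; apply: ereal_inf_lbound; exists pi. Qed.

Section Quantization.
Context {I : finType} (idx : X -> I) (p : I -> X).
Hypothesis measurable_cell : forall a, measurable (cell idx a).

Definition quantization_error (mu : set X -> \bar R) : \bar R :=
  (\int[mu]_x (dist x (p (idx x)))%:E)%E.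

Lemma measurable_quantizer : measurable_fun setT (p \o idx).
Proof.
move=> _ A mA; rewrite setTI.
rewrite (_ : _ @^-1` _ = \bigcup_(a in [set a | A (p a)]) cell idx a).
  by apply: fin_bigcup_measurable.
by apply/seteqP; split => [x /= Ax|x [a Aa xa]]; [exists (idx x)|rewrite /= xa].
Qed.

Lemma measurable_dist_quantizer :
  measurable_fun setT (fun x => dist x (p (idx x))).
Proof. exact: measurable_dist_comp measurable_quantizer. Qed.

Lemma measurable_quantized_dist :
  measurable_fun setT (fun z : X * X => dist (p (idx z.1)) (p (idx z.2))).
Proof.
by apply: measurable_dist_comp; exact: measurableT_comp measurable_quantizer _.
Qed.

Definition quantized_cost pi : R :=
  plan_cost (fun a b => dist (p a) (p b)) (coupling_plan idx pi).

Lemma cost_le_quantized mu nu pi : coupling mu nu pi ->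
  (transport_cost pi <=
   quantization_error mu + (quantized_cost pi)%:E + quantization_error nu)%E.
Proof.
move=> cpl; rewrite -(integral_coupling_plan measurable_cell)//.
apply: (coupling_integral_le cpl) => //.
- exact: measurable_dist_quantizer.
- exact: measurable_dist.
- exact: measurable_quantized_dist.
move=> z; rewrite (metric_sym z.2).
rewrite (le_trans (metric_triangle (p (idx z.2)) _ _))// lerD2r.
exact: metric_triangle.
Qed.

Lemma quantized_le_cost mu nu pi : coupling mu nu pi ->
  ((quantized_cost pi)%:E <=
   quantization_error mu + transport_cost pi + quantization_error nu)%E.
Proof.
move=> cpl; rewrite -(integral_coupling_plan measurable_cell)//.
apply: (coupling_integral_le cpl) => //.
- exact: measurable_dist_quantizer.
- exact: measurable_quantized_dist.
- exact: measurable_dist.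
move=> z; rewrite (le_trans (metric_triangle z.2 _ _))// lerD2r.
rewrite (le_trans (metric_triangle z.1 _ _))// lerD2r.
by rewrite metric_sym.
Qed.

Definition center_spread : R := \sum_a \sum_b dist (p a) (p b).

Lemma center_spread_ge0 : 0 <= center_spread.
Proof. by apply: sumr_ge0 => a _; exact: sumr_ge0. Qed.

Lemma dist_center_le_spread a b : dist (p a) (p b) <= center_spread.
Proof.
rewrite /center_spread (bigD1 a)//= (bigD1 b)//= -addrA lerDl addr_ge0//.
  exact: sumr_ge0.
by apply: sumr_ge0 => c _; exact: sumr_ge0.
Qed.

Definition quantized_close (e : R) (mu nu : set X -> \bar R) :=
  [/\ (quantization_error mu <= e%:E)%E, (quantization_error nu <= e%:E)%E &
      center_spread * \sum_a `|cell_mass idx mu a - cell_mass idx nu a| <= e].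

Lemma quantized_closeC e mu nu :
  quantized_close e mu nu -> quantized_close e nu mu.
Proof. by case=> ? ? ?; split=> //; under eq_bigr do rewrite distrC. Qed.

Lemma quantized_close_mixture (K : finType) (lam : K -> R)
    (lamP : convex_weights lam) (mus nus : K -> probability X R) e :
  (forall i, quantized_close e (mus i) (nus i)) ->
  quantized_close e (mixture_prob lamP mus) (mixture_prob lamP nus).
Proof.
move=> close; have [lam0 lam1] := lamP.
have error_le (rhos : K -> probability X R) :
    (forall i, quantization_error (rhos i) <= e%:E)%E ->
    (quantization_error (mixture_prob lamP rhos) <= e%:E)%E.
  move=> rhose; rewrite /quantization_error integral_mixture_prob.
  - exact: sum_mixture_le.
  - by apply/measurable_EFinP; exact: measurable_dist_quantizer.
  - by move=> x; rewrite lee_fin.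
split; [by apply: error_le => i; case: (close i)..|].
apply: (@le_trans _ _ (\sum_i lam i * (center_spread *
    \sum_a `|cell_mass idx (mus i) a - cell_mass idx (nus i) a|))); last first.
  rewrite -[e]mul1r -lam1 mulr_suml; apply: ler_sum => i _.
  by rewrite ler_wpM2l//; case: (close i).
under [leRHS]eq_bigr do rewrite mulrCA mulr_sumr.
rewrite -mulr_sumr exchange_big ler_wpM2l ?center_spread_ge0//.
apply: ler_sum => a _; rewrite !cell_mass_mixture_prob// -sumrB.
rewrite (le_trans (ler_norm_sum _ _ _))//.
by apply: ler_sum => i _; rewrite -mulrBr normrM ger0_norm.
Qed.

(* The 6 errors: 2 for quantizing a coupling of mu and nu into a plan, 2 for
   moving the plan to the cell masses of mu' and nu', 2 for realizing it. *)
Lemma W1_quantized_close e mu mu' nu nu' :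
  quantized_close e mu mu' -> quantized_close e nu nu' ->
  (W1 dist mu' nu' <= W1 dist mu nu + (6 * e)%:E)%E.
Proof.
move=> [emu emu' massmu] [enu enu' massnu].
rewrite -leeBlDr//; apply: le_ereal_inf_tmp => _ [pi cpl <-]; rewrite leeBlDr//.
have [M planM costM] : exists2 M,
    transport_plan (cell_mass idx mu') (cell_mass idx nu') M &
    plan_cost (fun a b => dist (p a) (p b)) M <= quantized_cost pi + 2 * e.
  have [|||M planM costM] := transport_plan_perturb
    (D := fun a b => dist (p a) (p b)) (coupling_planP measurable_cell cpl)
    (cell_mass_ge0 idx mu') (cell_mass_ge0 idx nu') _ _ _
    dist_center_le_spread center_spread_ge0.
  - by rewrite !sum_cell_mass.
  - by rewrite !sum_cell_mass.
  - by move=> a b; exact: metric_ge0.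
  exists M => //; apply: (le_trans costM).
  by rewrite lerD2l mulrDr mulr_natl mulr2n lerD.
apply: (le_trans (W1_le_cost (coupling_block measurable_cell planM))).
apply: (le_trans (cost_le_quantized (coupling_block measurable_cell planM))).
rewrite /quantized_cost coupling_plan_block.
apply: (@le_trans _ _ (e%:E + (quantized_cost pi + 2 * e)%:E + e%:E)%E).
  by rewrite leeD// leeD// lee_fin.
apply: (@le_trans _ _ ((e%:E + transport_cost pi + e%:E) + (4 * e)%:E)%E).
  rewrite -!EFinD (_ : e + _ + e = quantized_cost pi + 4 * e); last by ring.
  rewrite EFinD leeD2r// (le_trans (quantized_le_cost cpl))//.
  by rewrite leeD// leeD2r.
rewrite (addeC e%:E) -!addeA -!EFinD (_ : e + _ = 6 * e)//; ring.
Qed.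

Lemma objective_quantized_close J (mus mus' : 'I_J -> probability X R) nu nu'
    (eta e : R) (l : 'I_J -> R) :
  simplex l -> (forall j, quantized_close e (mus j) (mus' j)) ->
  quantized_close e nu nu' ->
  (objective dist eta (fun j => mus' j : set X -> \bar R) nu' l <=
   objective dist eta (fun j => mus j : set X -> \bar R) nu l + (6 * e)%:E)%E.
Proof.
move=> lP close closenu; rewrite /objective addeAC leeD2r//.
rewrite !(mixture_mixture_prob lP).
exact: W1_quantized_close (quantized_close_mixture lP close) closenu.
Qed.

Lemma empirical_objective_quantized_close T (Y1 : nat -> T -> X) J
    (Y : 'I_J -> nat -> T -> X) (P1 : probability X R)
    (P : 'I_J -> probability X R) (eta e : R) N w :
  (0 < N)%N -> quantized_close e P1 (empirical N Y1 w) ->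
  (forall j, quantized_close e (P j) (empirical N (Y j) w)) ->
  simplex_close (objective dist eta (fun j => P j : set X -> \bar R) P1)
    (objective dist eta (fun j => empirical N (Y j) w) (empirical N Y1 w))
    (6 * e).
Proof.
move=> N0; rewrite (empirical_empirical_prob _ N0) => close1 close.
have empiricalE j := empirical_empirical_prob (R := R) (Y j) N0 w.
rewrite (funext empiricalE : (fun j => empirical N (Y j) w) = _).
have {}close j : quantized_close e (P j) (empirical_prob (Y j) N0 w).
  by rewrite -empiricalE.
move=> l lP; split; apply: objective_quantized_close => //.
  by move=> j; exact: quantized_closeC.
exact: quantized_closeC.
Qed.

Lemma empirical_quantized_close d' (Omega : measurableType d')
    (Pr : probability Omega R) (Z : nat -> Omega -> X) (P : probability X R)
    (e kappa : R) :
  iid_with_law Pr Z P -> 0 < e -> 0 < kappa ->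
  (quantization_error P <= e%:E)%E ->
  (quantization_error P <= (e * (kappa / 2))%:E)%E ->
  \forall N \near \oo, outer_prob_le Pr
    [set w | ~ quantized_close e P (empirical N Z w)] kappa.
Proof.
move=> iid e0 kappa0 eP eP'.
have spread0 := center_spread_ge0.
have I0 : 0 < #|I|%:R :> R.
  by rewrite ltr0n; apply/card_gt0P; exists (idx point).
have den0 : 0 < center_spread * #|I|%:R + 1 by rewrite ltr_wpDl ?mulr_ge0.
pose c := e / (center_spread * #|I|%:R + 1).
have c0 : 0 < c by rewrite divr_gt0.
have spread_c : center_spread * (#|I|%:R * c) <= e.
  by rewrite /c mulrA mulrCA ler_piMr ?(ltW e0)// ler_pdivrMr// mul1r lerDl.
have : \forall N \near \oo, forall a, outer_prob_le Pr
    [set w | c < `|cell_mass idx (empirical N Z w) a - cell_mass idx P a|]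
    (kappa / 2 / #|I|%:R).
  apply: filter_forall => a; apply: filterS
    (sample_frequency_concentration iid (measurable_cell a) c0 _) => [N|].
    by apply: outer_prob_leS => // w /=; rewrite cell_mass_empirical.
  by rewrite !divr_gt0.
apply: filter_app; near=> N => frequency_error.
have N0 : (0 < N)%N by near: N; exact: nbhs_infty_gt.
have mean_error := sample_mean_outer_prob iid N0 measurable_dist_quantizer
  (fun x => metric_ge0 x _) e0 eP'.
apply: (outer_prob_leS _ _ (outer_prob_leU mean_error
  (outer_prob_le_bigcup frequency_error))); last first.
  by rewrite sumr_const -[X in _ + X <= _]mulr_natr divfK ?gt_eqF// -splitr.
move=> w /= notclose; apply: contrapT => /not_orP[/negP + frequencies].
rewrite -leNgt => mean; apply: notclose; split=> //.
  rewrite /quantization_error integral_empirical//.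
  exact: measurable_dist_quantizer.
apply: le_trans spread_c; rewrite ler_wpM2l// mulr_natl -sumr_const.
apply: ler_sum => a _; rewrite distrC leNgt; apply/negP => ca.
by apply: frequencies; exists a.
Unshelve. all: by end_near. Qed.

End Quantization.

Section NetQuantizer.
Variables (s : nat -> X) (y0 : X) (delta : R).

Definition close_net_points K x : {set 'I_K} :=
  [set n : 'I_K | dist (s n) x < delta]%SET.

Definition net_center K (A : {set 'I_K}) : X :=
  if [pick n in A] is Some n then s n else y0.

Lemma measurable_cell_close_net_points K A :
  measurable (cell (@close_net_points K) A).
Proof.
rewrite (_ : cell _ _ = \bigcap_(n in [set: 'I_K])
    [set x | (dist (s n) x < delta) = (n \in A)]).
  apply: fin_bigcap_measurable => // n _; case: (n \in A).
    exact/measurable_sublevel/measurable_dist_from.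
  rewrite (_ : mkset _ = ~` [set x | dist (s n) x < delta]).
    exact/measurableC/measurable_sublevel/measurable_dist_from.
  by apply/seteqP; split => x /= => [->|/negP/negbTE].
apply/seteqP; split => [x /= <- n _|x xA]; first by rewrite inE.
by apply/finset.setP => n; rewrite inE xA.
Qed.

Lemma dist_net_center_le K x : 0 < delta ->
  dist x (net_center (close_net_points K x)) <=
  delta + (dist ^~ y0 \_ (cell (@close_net_points K) finset.set0)) x.
Proof.
move=> delta0; rewrite patchE /net_center; case: pickP => [n|nonear].
  rewrite inE metric_sym => xn; rewrite (le_trans (ltW xn))// lerDl.
  by case: ifP.
rewrite mem_set ?lerDr ?ltW// /cell /=.
by apply/finset.setP => n; rewrite !inE; have := nonear n; rewrite inE.
Qed.

Lemma near_close_net_points x : (exists n, dist x (s n) < delta) ->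
  \forall K \near \oo, ~ cell (@close_net_points K) finset.set0 x.
Proof.
move=> [n xn]; exists n.+1 => // K /= nK /finset.setP/(_ (Ordinal nK)).
by rewrite !inE /= metric_sym xn.
Qed.

Lemma quantization_error_net_le K mu : 0 < delta ->
  (quantization_error (@close_net_points K) (@net_center K) mu <=
   delta%:E + \int[mu]_(x in cell (@close_net_points K) finset.set0)
     (dist x y0)%:E)%E.
Proof.
move=> delta0; set far := cell _ _.
have mfar : measurable far by exact: measurable_cell_close_net_points.
have /measurable_EFinP mdist0 : measurable_fun setT ((dist ^~ y0) \_ far).
  apply/(measurable_restrictT _ _).1 => //.
  by apply: (measurable_funS measurableT) => //; exact: measurable_dist_comp.
apply: (@le_trans _ _ (\int[mu]_x (delta%:E + (((dist ^~ y0) \_ far) x)%:E))%E).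
  apply: ge0_le_integral => //.
  - by move=> x _; rewrite lee_fin.
  - apply/measurable_EFinP; apply: measurable_dist_quantizer.
    exact: measurable_cell_close_net_points.
  - exact: emeasurable_funD.
  - by move=> x _; rewrite -EFinD lee_fin dist_net_center_le.
rewrite ge0_integralD//; last 2 first.
- by move=> x _; rewrite lee_fin ltW.
- by move=> x _; rewrite lee_fin patchE; case: ifP.
rewrite integral_cst// [X in (_ * X)%E](_ : _ = 1%E); last first.
  exact: probability_setT.
rewrite mule1 leeD2l// [leRHS]integral_mkcond.
by under [leRHS]eq_integral do rewrite restrict_EFin.
Qed.

End NetQuantizer.

Lemma quantizer_exists (K : finType) (P : K -> probability X R) (y0 : X)
    (eps : R) :
  (forall i, \int[P i]_y (dist y y0)%:E < +oo)%E -> 0 < eps ->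
  exists (I : finType) (idx : X -> I) (p : I -> X),
    (forall a, measurable (cell idx a)) /\
    (forall i, quantization_error idx p (P i) <= eps%:E)%E.
Proof.
move=> Poo eps0; have [/(_ point)//|[s sd]] := dist_separable.
have delta0 : 0 < eps / 2 by rewrite divr_gt0.
pose far n := cell (@close_net_points s (eps / 2) n) finset.set0.
have mfar n : measurable (far n) by exact: measurable_cell_close_net_points.
have mdist0 : measurable_fun setT (dist ^~ y0) by exact: measurable_dist_comp.
have [n _ /(_ n (leqnn n))/= tail] : \forall n \near \oo,
    forall i, (\int[P i]_(x in far n) (dist x y0)%:E < (eps / 2)%:E)%E.
  have near0 : nbhs (0%E : \bar R) [set y | (y < (eps / 2)%:E)%E].
    by apply: open_ereal_lt'; rewrite lte_fin.
  apply: filter_forall => i.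
  exact: (cvg_integral_vanishing_sets mfar mdist0 (metric_ge0^~ y0) (Poo i)
    (fun x => near_close_net_points (sd x _ delta0)) near0).
exists {set 'I_n}, (@close_net_points s (eps / 2) n), (@net_center s y0 n).
split=> [A|i]; first exact: measurable_cell_close_net_points.
apply: (le_trans (quantization_error_net_le s y0 n (P i) delta0)).
by rewrite [eps in leRHS]splitr EFinD leeD2l// ltW.
Qed.

Lemma W1_fin_num mu nu y0 :
  (\int[mu]_y (dist y y0)%:E < +oo)%E -> (\int[nu]_y (dist y y0)%:E < +oo)%E ->
  W1 dist mu nu \is a fin_num.
Proof.
move=> muoo nuoo; rewrite ge0_fin_numE ?W1_ge0//.
have cpl := coupling_product mu nu; apply: (le_lt_trans (W1_le_cost cpl)).
have : (transport_cost (mu \x nu)%E <= \int[mu]_y (dist y y0)%:E +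
    \int[(mu \x nu)%E]_z 0%:E + \int[nu]_y (dist y y0)%:E)%E.
  apply: (coupling_integral_le (e := dist ^~ y0) cpl) => //.
  - exact: measurable_dist_comp.
  - exact: measurable_dist.
  - by move=> z; rewrite addr0 (metric_sym z.2); exact: metric_triangle.
by move=> /le_lt_trans; apply; rewrite integral0 adde0 lte_add_pinfty.
Qed.

Lemma W1_mixture (K : finType) (lam : K -> R) (lamP : convex_weights lam)
    (mus nus : K -> probability X R) :
  (forall i, W1 dist (mus i) (nus i) \is a fin_num) ->
  (W1 dist (mixture_prob lamP mus) (mixture_prob lamP nus) <=
   \sum_i (lam i)%:E * W1 dist (mus i) (nus i))%E.
Proof.
move=> W1fin; apply/lee_addgt0Pr => e e0.
have /choice[pi piP] : forall i, exists pi, coupling (mus i) (nus i) pi /\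
    (transport_cost pi <= W1 dist (mus i) (nus i) + e%:E)%E.
  move=> i; have [_ [pi cpl <-] pie] := lb_ereal_inf_adherent e0 (W1fin i).
  by exists pi; split=> //; exact: ltW.
have cpl := coupling_mixture lamP (fun i => proj1 (piP i)).
apply: (le_trans (W1_le_cost cpl)).
rewrite /transport_cost integral_mixture_prob.
- have -> : (e%:E = \sum_i (lam i)%:E * e%:E)%E.
    under eq_bigr do rewrite -EFinM.
    by rewrite sumEFin -mulr_suml (proj2 lamP) mul1r.
  rewrite -big_split; apply: lee_sum => i _ /=.
  rewrite -muleDr// ?fin_num_adde_defl// lee_wpmul2l//.
    by rewrite lee_fin (proj1 lamP).
  exact: proj2 (piP i).
- by apply/measurable_EFinP; exact: measurable_dist.
- by move=> z; rewrite lee_fin.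
Qed.

Section Objective.
Variables (J : nat) (mus : 'I_J -> probability X R) (nu : probability X R).
Variables (eta : R) (y0 : X).
Hypothesis mus_moment : forall j, (\int[mus j]_y (dist y y0)%:E < +oo)%E.
Hypothesis nu_moment : (\int[nu]_y (dist y y0)%:E < +oo)%E.
Hypothesis eta_gt0 : 0 < eta.
Implicit Types l : 'I_J -> R.

Let population_W1 l :=
  W1 dist (mixture l (fun j => mus j : set X -> \bar R)) nu.
Let population_objective := objective dist eta
  (fun j => mus j : set X -> \bar R) nu.

Let population_W1_fin_num l : simplex l -> population_W1 l \is a fin_num.
Proof.
move=> lP; rewrite /population_W1 (mixture_mixture_prob lP).
apply: (W1_fin_num (y0 := y0)) => //; rewrite integral_mixture_prob.
- apply: lte_sum_pinfty => j _; rewrite lte_mul_pinfty// ?lee_fin//.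
  by case: lP.
- by apply/measurable_EFinP; exact: measurable_dist_comp.
- by move=> x; rewrite lee_fin.
Qed.

Let population_W1_midpoint l l' : simplex l -> simplex l' ->
  2 * fine (population_W1 (fun i => (l i + l' i) / 2)) <=
  fine (population_W1 l) + fine (population_W1 l').
Proof.
move=> lP l'P; have midP := convex_weights_midpoint lP l'P.
pose rho (b : bool) := if b then mixture_prob lP mus else mixture_prob l'P mus.
have rhoW1 b : W1 dist (rho b) nu = population_W1 (if b then l else l').
  by rewrite /population_W1 /rho; case: b; rewrite mixture_mixture_prob.
have midE : mixture_prob midP mus =
    mixture_prob convex_weights_half rho :> (set X -> \bar R).
  apply/funext => A; rewrite (mixture_prob_midpoint lP l'P).
  by rewrite [RHS]mixture_probE big_bool.
have nuE : nu = mixture_prob convex_weights_half (fun=> nu)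
    :> (set X -> \bar R).
  by apply/funext => A; rewrite [RHS]mixture_prob_cst.
rewrite -ler_pdivlMl// -lee_fin fineK; last exact: population_W1_fin_num.
rewrite /population_W1 (mixture_mixture_prob midP) midE [X in W1 _ _ X]nuE.
apply: (le_trans (W1_mixture _ _)) => [b|].
  by rewrite rhoW1; case: b; exact: population_W1_fin_num.
rewrite big_bool !rhoW1 mulrDr EFinD !EFinM.
by rewrite !fineK// population_W1_fin_num.
Qed.

Lemma objective_fin_num l : simplex l -> population_objective l \is a fin_num.
Proof. by move=> lP; rewrite fin_numD population_W1_fin_num. Qed.

Lemma objective_strong_midpoint_convex l l' : simplex l -> simplex l' ->
  2 * fine (population_objective (fun i => (l i + l' i) / 2)) +
    eta * (\sum_i (l i - l' i) ^+ 2) / 8 <=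
  fine (population_objective l) + fine (population_objective l').
Proof.
move=> lP l'P; have midP := convex_weights_midpoint lP l'P.
rewrite /population_objective /objective !fineD ?population_W1_fin_num//=.
have := population_W1_midpoint lP l'P; rewrite /population_W1.
have := sum_xlogx_midpoint (convex_weights_itv lP) (convex_weights_itv l'P).
by move=> /(ler_wpM2l (ltW eta_gt0)); lra.
Qed.

Lemma near_argmin_close lstar l (e : R) :
  is_argmin population_objective lstar -> simplex l ->
  (population_objective l <= population_objective lstar + e%:E)%E ->
  eta * \sum_i (l i - lstar i) ^+ 2 <= 8 * e.
Proof.
move=> [starP star_min] lP Ql.
have midP := convex_weights_midpoint lP starP.
have := objective_strong_midpoint_convex lP starP.
move: (star_min _ midP) Ql.
rewrite -(fineK (objective_fin_num starP)) -(fineK (objective_fin_num midP)).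
rewrite -(fineK (objective_fin_num lP)) -EFinD !lee_fin /=; lra.
Qed.

Lemma argmin_l1_close lstar (Q : ('I_J -> R) -> \bar R) l (eps : R) :
  0 < eps -> is_argmin population_objective lstar -> is_argmin Q l ->
  simplex_close population_objective Q (eta * eps ^+ 2 / (16 * J.+1%:R)) ->
  \sum_i `|l i - lstar i| <= eps.
Proof.
move=> eps0 starP lP close.
have := near_argmin_close starP (proj1 lP) (argmin_perturbation starP lP close).
rewrite (_ : 8 * _ = eta * (eps ^+ 2 / J.+1%:R)); last first.
  by field; rewrite nat1r pnatr_eq0.
rewrite ler_pM2l// ler_pdivlMr ?ltr0n// => l2_close.
rewrite -(@ler_pXn2r _ 2) ?nnegrE ?(ltW eps0)//; last exact: sumr_ge0.
apply: (le_trans (sqr_sum_norm_le _)); apply: le_trans l2_close.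
rewrite card_ord mulrC ler_wpM2l ?ler_nat// sumr_ge0// => i _.
exact: sqr_ge0.
Qed.

End Objective.

Lemma empirical_objective_close d' (Omega : measurableType d')
    (Pr : probability Omega R) J (P1 : probability X R)
    (P : 'I_J -> probability X R) (Y1 : nat -> Omega -> X)
    (Y : 'I_J -> nat -> Omega -> X) (eta : R) (y0 : X) (e kappa : R) :
  (\int[P1]_y (dist y y0)%:E < +oo)%E ->
  (forall j, \int[P j]_y (dist y y0)%:E < +oo)%E ->
  iid_with_law Pr Y1 P1 -> (forall j, iid_with_law Pr (Y j) (P j)) ->
  0 < e -> 0 < kappa ->
  \forall N \near \oo, outer_prob_le Pr [set w | ~ simplex_close
    (objective dist eta (fun j => P j : set X -> \bar R) P1)
    (objective dist eta (fun j => empirical N (Y j) w) (empirical N Y1 w)) e]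
    kappa.
Proof.
move=> P1oo Poo iid1 iid e0 kappa0.
pose law (o : option 'I_J) := if o is Some j then P j else P1.
pose sample (o : option 'I_J) := if o is Some j then Y j else Y1.
pose kappa' := kappa / #|{: option 'I_J}|%:R.
have card0 : 0 < #|{: option 'I_J}|%:R :> R by rewrite card_option.
have kappa'0 : 0 < kappa' by rewrite divr_gt0.
have e60 : 0 < e / 6 by rewrite divr_gt0.
have eps0 : 0 < Num.min (e / 6) (e / 6 * (kappa' / 2)).
  by rewrite lt_min e60 mulr_gt0// divr_gt0.
have lawoo o : (\int[law o]_y (dist y y0)%:E < +oo)%E by case: o.
have [I [idx [p [mcell error_le]]]] := quantizer_exists lawoo eps0.
have : \forall N \near \oo, forall o, outer_prob_le Pr [set w |
    ~ quantized_close idx p (e / 6) (law o) (empirical N (sample o) w)] kappa'.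
  apply: filter_forall => o; apply: empirical_quantized_close => //.
  - by case: o.
  - by rewrite (le_trans (error_le o))// lee_fin ge_min lexx.
  - by rewrite (le_trans (error_le o))// lee_fin ge_min lexx orbT.
apply: filter_app; near=> N => sample_close.
have N0 : (0 < N)%N by near: N; exact: nbhs_infty_gt.
apply: (outer_prob_leS _ _ (outer_prob_le_bigcup sample_close)); last first.
  by rewrite sumr_const -[leLHS]mulr_natr divfK ?gt_eqF.
move=> w /= notclose; apply: contrapT => sample_good; apply: notclose.
have close o : quantized_close idx p (e / 6) (law o) (empirical N (sample o) w).
  by apply: contrapT => bad; apply: sample_good; exists o.
rewrite (_ : e = 6 * (e / 6)); last by rewrite mulrC divfK.
apply: (empirical_objective_quantized_close mcell) => // [|j].
  exact: close None.
exact: close (Some j).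
Unshelve. all: by end_near. Qed.

End Wasserstein.

Theorem theorem3 (R : realType)
  (dX : measure_display) (X : measurableType dX) (dist : X -> X -> R)
  (dO : measure_display) (Omega : measurableType dO) (Pr : probability Omega R)
  (J : nat) (P1 : probability X R) (P : 'I_J -> probability X R)
  (eta : R)
  (Y1 : nat -> Omega -> X) (Y : 'I_J -> nat -> Omega -> X)
  (lamhat : nat -> Omega -> 'I_J -> R) (lamstar : 'I_J -> R) :
  is_metric dist -> metric_complete dist -> metric_separable dist ->
  @measurable _ X = <<s metric_open dist >> ->
  (exists y0 : X, (\int[P1]_y (dist y y0)%:E < +oo)%E /\
                  forall j, (\int[P j]_y (dist y y0)%:E < +oo)%E) ->
  (forall alpha : 'I_J -> R, \sum_(j < J) alpha j = 0 ->
     (forall A : set X, measurable A -> (\sum_(j < J) (alpha j)%:E * P j A)%E = 0%E) ->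
     forall j, alpha j = 0) ->
  0 < eta ->
  iid_with_law Pr Y1 P1 -> (forall j, iid_with_law Pr (Y j) (P j)) ->
  (forall N w, (0 < N)%N ->
     is_argmin (objective dist eta (fun j => empirical N (Y j) w) (empirical N Y1 w))
               (lamhat N w)) ->
  is_argmin (objective dist eta (fun j => (P j : set X -> \bar R)) (P1 : set X -> \bar R))
            lamstar ->
  cvg_in_outer_prob Pr lamhat lamstar.
Proof.
move=> metric _ separable borel [y0 [P1oo Poo]] _ eta0 iid1 iid.
move=> hat_min star_min eps delta eps0 delta0.
pose e := eta * eps ^+ 2 / (16 * J.+1%:R).
have e0 : 0 < e by rewrite divr_gt0 ?mulr_gt0 ?exprn_gt0.
have half_delta0 : 0 < delta / 2 by rewrite divr_gt0.
have [N0 _ uniform] := empirical_objective_close metric separable borel eta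
  P1oo Poo iid1 iid e0 half_delta0.
exists N0.+1 => N N0N; have [B [mB notcloseB] PB] := uniform N (ltnW N0N).
exists B; last first.
  by rewrite (le_lt_trans PB)// lte_fin ltr_pdivrMr// ltr_pMr// ltr1n.
split=> //; apply: subset_trans notcloseB => w /= far close; move: far.
apply/negP; rewrite -leNgt.
apply: (argmin_l1_close metric separable borel Poo P1oo eta0 eps0 star_min _
  close).
by apply: hat_min; exact: leq_ltn_trans N0N.
Qed.
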